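(* Let $m,n\in\mathbb{N}$ be positive integers and let $T_m$ be an $m$-th Calderón-Zygmund type singular integral on $\mathbb{R}^n$. Let $x_0\in\mathbb{R}^n$ and let $1<p,p_1,p_2,\dots,p_m<\infty$ be such that $1/p=1/p_1+1/p_2+\dots+1/p_m$. Then there is a constant $C>0$, independent of $r$ and of $f_1,\dots,f_m$, such that the inequality $$\|T_m(f_1,\dots,f_m)\|_{L^p(B(x_0,r))}\le C\, r^{n/p}\int_{2r}^{\infty}\prod_{i=1}^{m}\|f_i\|_{L^{p_i}(B(x_0,t))}\,t^{-n/p-1}\,dt$$ holds for every $r>0$ and all $f_i\in L^{p_i}_{loc}(\mathbb{R}^n)$, $i=1,\dots,m$.
   Context: $B(x_0,r)$ is the ball in $\mathbb{R}^n$ with center $x_0$ and radius $r$. **$m$-th Calderón-Zygmund type singular integral.** Let $K(y_0,y_1,\dots,y_m)$ be a function defined away from the diagonal $y_0=y_1=\dots=y_m$ in $(\mathbb{R}^n)^{m+1}$ such that, for some $C>0$ and $\epsilon>0$, $$|K(y_0,y_1,\dots,y_m)|\le \frac{C}{\left(\sum_{k,l=0}^m|y_k-y_l|\right)^{mn}}$$ for all $(y_0,\dots,y_m)$ away from the diagonal, and $$|K(y_0,\dots,y_i,\dots,y_m)-K(y_0,\dots,y_i',\dots,y_m)|\le \frac{C|y_i-y_i'|^{\epsilon}}{\left(\sum_{k,l=0}^m|y_k-y_l|\right)^{mn+\epsilon}}$$ whenever $0\le i\le m$ and $|y_i-y_i'|\le \frac12\max_{0\le k\le m}|y_i-y_k|$.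 An $m$-th Calderón-Zygmund type singular integral is an $m$-linear operator $T_m$, initially defined on the $m$-fold product of the Schwartz space $\mathcal{S}(\mathbb{R}^n)$ with values in the tempered distributions $\mathcal{S}'(\mathbb{R}^n)$, such that $$T_m(f_1,\dots,f_m)(x)=\int_{(\mathbb{R}^n)^m}K(x,y_1,\dots,y_m)f_1(y_1)\cdots f_m(y_m)\,dy_1\cdots dy_m$$ whenever $f_1,\dots,f_m$ are smooth with compact support and $x\notin\bigcap_{i=1}^m \mathrm{supp} f_i$. Standing fact about such operators: for all $1<s_1,\dots,s_m<\infty$ and $1/s=1/s_1+\dots+1/s_m$, $T_m$ extends to a bounded operator $L^{s_1}\times\dots\times L^{s_m}\to L^s$, i.e. $\|T_m(f_1,\dots,f_m)\|_{L^s}\le C\prod_i\|f_i\|_{L^{s_i}}$. **Convention for locally integrable arguments.** For $f_i\in L^{p_i}_{loc}$, put $B=B(x_0,r)$, $2B=B(x_0,2r)$, $f_i^0=f_i\chi_{2B}$, $f_i^\infty=f_i\chi_{(2B)^c}$. On $B$, $T_m(f_1,\dots,f_m)$ means $T_m(f_1^0,\dots,f_m^0)$ (given by the bounded extension) plus the sum, over all other choices $(\alpha_1,\dots,\alpha_m)\in\{0,\infty\}^m$, of the integrals $\int K(x,y_1,\dots,y_m)\prod_i f_i^{\alpha_i}(y_i)\,dy_1\cdots dy_m$, which converge absolutely whenever the right-hand side of the claimed inequality is finite. If the right-hand side is infinite, the inequality is regarded as trivially true. *)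

(* Defs.v *)
From HB Require Import structures.
From mathcomp Require Import all_boot all_order all_algebra.
From mathcomp Require Import complex.
From mathcomp Require Import all_classical all_reals all_analysis.

Set Implicit Arguments.
Unset Strict Implicit.
Unset Printing Implicit Defensive.

Import Order.TTheory GRing.Theory Num.Theory.
Import numFieldNormedType.Exports.
Import Normc.

Local Open Scope classical_set_scope.
Local Open Scope ring_scope.

(* Product measure mu^k on k-tuples, built by iterating the binary product. *)
Section power_measure.
Local Open Scope ereal_scope.
Context d (T : measurableType d) (R : realType).

Definition tcons k (z : T * k.-tuple T) : k.+1.-tuple T :=
  [tuple of z.1 :: z.2].

Definition tuncons k (t : k.+1.-tuple T) : T * k.-tuple T :=
  (thead t, [tuple of behead t]).

Lemma tconsK k : cancel (@tcons k) (@tuncons k).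
Proof. by case=> x t; congr pair => //; apply/val_inj. Qed.

Lemma tunconsK k : cancel (@tuncons k) (@tcons k).
Proof. by move=> t; rewrite /tcons/= -tuple_eta. Qed.

Lemma measurable_tcons k : measurable_fun [set: T * k.-tuple T] (@tcons k).
Proof. exact: (measurable_cons measurable_fst measurable_snd). Qed.

Lemma measurable_tuncons k : measurable_fun [set: k.+1.-tuple T] (@tuncons k).
Proof.
by apply: measurable_fun_pair; [exact: measurable_tnth|exact: measurable_behead].
Qed.

Variable mu : {sigma_finite_measure set T -> \bar R}.

Definition power_step k (nu : {sigma_finite_measure set (k.-tuple T) -> \bar R})
    : set (k.+1.-tuple T) -> \bar R :=
  pushforward (mu \x nu) (@tcons k).

Section power_step.
Variables (k : nat) (nu : {sigma_finite_measure set (k.-tuple T) -> \bar R}).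

Let power_step0 : power_step nu set0 = 0.
Proof. by rewrite /power_step /pushforward preimage_set0 measure0. Qed.

Let power_step_ge0 A : 0 <= power_step nu A.
Proof. by rewrite /power_step /pushforward measure_ge0. Qed.

Let power_step_sigma_additive : semi_sigma_additive (power_step nu).
Proof.
move=> F mF tF mUF; rewrite /power_step /pushforward preimage_bigcup.
have mtF i : measurable (@tcons k @^-1` F i).
  by rewrite -[X in measurable X]setTI; exact: measurable_tcons.
apply: measure_semi_sigma_additive => //; last exact: bigcupT_measurable.
apply/trivIsetP => /= i j _ _ ij; rewrite -preimage_setI.
by move/trivIsetP : tF => /(_ _ _ _ _ ij) ->//; rewrite preimage_set0.
Qed.

HB.instance Definition _ := isMeasure.Build _ _ _ (power_step nu)
  power_step0 power_step_ge0 power_step_sigma_additive.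

Let power_step_sigma_finite : sigma_finite setT (power_step nu).
Proof.
have /sigma_finiteP[F [TF ndF Foo]] := sigma_finiteT mu.
have /sigma_finiteP[G [TG ndG Goo]] := sigma_finiteT nu.
exists (fun i => @tuncons k @^-1` (F i `*` G i)).
  rewrite -preimage_bigcup (_ : \bigcup_i (F i `*` G i) = setT) ?preimage_setT//.
  apply/seteqP; split => // -[x y] _.
  have : [set: T] x by []. have : [set: k.-tuple T] y by [].
  rewrite TF TG => -[j _ Gjy] [i _ Fix].
  exists (maxn i j) => //; split => /=.
    by move: x Fix; exact/subsetPset/ndF/leq_maxl.
  by move: y Gjy; exact/subsetPset/ndG/leq_maxr.
move=> i; have [mFi Fioo] := Foo i; have [mGi Gioo] := Goo i; split.
  rewrite -[X in measurable X]setTI; apply: measurable_tuncons => //.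
  exact: measurableX.
rewrite /power_step /pushforward -comp_preimage.
rewrite (_ : @tuncons k \o @tcons k = id); last exact/funext/tconsK.
by rewrite preimage_id product_measure1E// lte_mul_pinfty// ge0_fin_numE.
Qed.

HB.instance Definition _ := Measure_isSigmaFinite.Build _ _ _ (power_step nu)
  power_step_sigma_finite.

End power_step.

Fixpoint power_measure k : {sigma_finite_measure set (k.-tuple T) -> \bar R} :=
  match k with
  | 0 => \d_([tuple] : 0.-tuple T)
  | k'.+1 => power_step (power_measure k')
  end.

End power_measure.

(* Borel sigma-algebra of R^n, generated by the coordinate functions. *)
Definition rV_display : measure_display -> measure_display.
Proof. exact. Qed.

Section measurable_rV.
Context d (T : measurableType d) (n : nat).

Let coord (i : 'I_n) (x : 'rV[T]_n) : T := x ord0 i.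

Let rV_set0 : g_sigma_preimage coord set0.
Proof. exact: sigma_algebra0. Qed.

Let rV_setC A : g_sigma_preimage coord A -> g_sigma_preimage coord (~` A).
Proof. exact: sigma_algebraC. Qed.

Let rV_bigcup (F : (set 'rV[T]_n)^nat) : (forall i, g_sigma_preimage coord (F i)) ->
  g_sigma_preimage coord (\bigcup_i (F i)).
Proof. exact: sigma_algebra_bigcup. Qed.

HB.instance Definition _ := @isMeasurable.Build (rV_display d)
  'rV[T]_n (g_sigma_preimage coord) rV_set0 rV_setC rV_bigcup.

End measurable_rV.

Section lebesgue_rV.
Local Open Scope ereal_scope.
Context (R : realType) (n : nat).

Definition rV_of_tuple (t : n.-tuple R) : 'rV[R]_n := \row_i tnth t i.

Definition tuple_of_rV (x : 'rV[R]_n) : n.-tuple R := [tuple x ord0 i | i < n].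

Lemma rV_of_tupleK : cancel rV_of_tuple tuple_of_rV.
Proof. by move=> t; apply/eq_from_tnth => i; rewrite tnth_mktuple mxE. Qed.

Lemma measurable_coord_rV (i : 'I_n) :
  measurable_fun [set: 'rV[R]_n] (fun x : 'rV[R]_n => x ord0 i).
Proof.
move=> _ Y mY; rewrite setTI; apply: sub_sigma_algebra => /=.
rewrite -bigcup_seq/=; exists i => /=; first by rewrite mem_index_enum.
by exists Y => //; rewrite setTI.
Qed.

Lemma measurable_tuple_of_rV : measurable_fun [set: 'rV[R]_n] tuple_of_rV.
Proof.
apply/measurable_fun_tnthP => i.
rewrite (_ : _ \o _ = fun x : 'rV[R]_n => x ord0 i).
  exact: measurable_coord_rV.
by apply/funext => x /=; rewrite tnth_mktuple.
Qed.

Lemma measurable_rV_of_tuple : measurable_fun [set: n.-tuple R] rV_of_tuple.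
Proof.
apply: (measurability (\big[setU/set0]_(i < n)
  preimage_set_system setT (fun x : 'rV[R]_n => x ord0 i) measurable)) => //.
move=> _ [B + <-]; rewrite -bigcup_seq/= => -[i _ [C mC <-]].
rewrite !setTI -comp_preimage (_ : _ \o _ = @tnth _ _ ^~ i).
  by rewrite -[X in measurable X]setTI; exact: measurable_tnth.
by apply/funext => t /=; rewrite mxE.
Qed.

Definition lebesgue_rV : set 'rV[R]_n -> \bar R :=
  pushforward (power_measure (@lebesgue_measure R) n) rV_of_tuple.

Let lebesgue_rV0 : lebesgue_rV set0 = 0.
Proof. by rewrite /lebesgue_rV /pushforward preimage_set0 measure0. Qed.

Let lebesgue_rV_ge0 A : 0 <= lebesgue_rV A.
Proof. by rewrite /lebesgue_rV /pushforward measure_ge0. Qed.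

Let lebesgue_rV_sigma_additive : semi_sigma_additive lebesgue_rV.
Proof.
move=> F mF tF mUF; rewrite /lebesgue_rV /pushforward preimage_bigcup.
have mtF i : measurable (rV_of_tuple @^-1` F i).
  by rewrite -[X in measurable X]setTI; exact: measurable_rV_of_tuple.
apply: measure_semi_sigma_additive => //; last exact: bigcupT_measurable.
apply/trivIsetP => /= i j _ _ ij; rewrite -preimage_setI.
by move/trivIsetP : tF => /(_ _ _ _ _ ij) ->//; rewrite preimage_set0.
Qed.

HB.instance Definition _ := isMeasure.Build _ _ _ lebesgue_rV
  lebesgue_rV0 lebesgue_rV_ge0 lebesgue_rV_sigma_additive.

Let lebesgue_rV_sigma_finite : sigma_finite setT lebesgue_rV.
Proof.
have [F UF mF] := sigma_finiteT (power_measure (@lebesgue_measure R) n).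
exists (fun i => tuple_of_rV @^-1` F i).
  by rewrite -preimage_bigcup -UF preimage_setT.
move=> i; have [mFi Fioo] := mF i; split.
  by rewrite -[X in measurable X]setTI; exact: measurable_tuple_of_rV.
rewrite /lebesgue_rV /pushforward -comp_preimage.
by rewrite (_ : tuple_of_rV \o rV_of_tuple = id)//; exact/funext/rV_of_tupleK.
Qed.

HB.instance Definition _ := Measure_isSigmaFinite.Build _ _ _ lebesgue_rV
  lebesgue_rV_sigma_finite.

End lebesgue_rV.

Section euclidean.
Context (R : realType) (n : nat).

(* The library norm `|x| on 'rV[R]_n is the sup norm. *)
Definition enorm (x : 'rV[R]_n) : R := Num.sqrt (\sum_i x ord0 i ^+ 2).

Definition eball (x0 : 'rV[R]_n) (r : R) : set 'rV[R]_n :=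
  [set x | enorm (x - x0) < r].

End euclidean.

Definition reC (X : Type) (R : realType) (f : X -> R[i]) (x : X) : R :=
  complex.Re (f x).

Definition imC (X : Type) (R : realType) (f : X -> R[i]) (x : X) : R :=
  complex.Im (f x).

Section complex_functions.
Context d (X : measurableType d) (R : realType).
Variable mu : {measure set X -> \bar R}.

Definition cmeasurable (f : X -> R[i]) : Prop :=
  measurable_fun [set: X] (reC f) /\ measurable_fun [set: X] (imC f).

Definition cintegrable (f : X -> R[i]) : Prop :=
  mu.-integrable [set: X] (EFin \o reC f) /\
  mu.-integrable [set: X] (EFin \o imC f).

Definition cintegral (f : X -> R[i]) : R[i] :=
  Complex (\int[mu]_x reC f x) (\int[mu]_x imC f x).

Definition cabs_integral (f : X -> R[i]) : \bar R :=
  (\int[mu]_x (normc (f x))%:E)%E.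

Definition cLnorm (s : R) (A : set X) (f : X -> R[i]) : \bar R :=
  ('N[mu]_s%:E[(fun x => (normc (f x))%:E) \_ A])%E.

Definition cLp (s : R) (f : X -> R[i]) : Prop :=
  cmeasurable f /\ (cLnorm s setT f < +oo)%E.

End complex_functions.

Definition cLp_loc (R : realType) n (s : R) (f : 'rV[R]_n -> R[i]) : Prop :=
  cmeasurable f /\
  forall A : set 'rV[R]_n, compact A -> (cLnorm (@lebesgue_rV R n) s A f < +oo)%E.

Section schwartz.
Context (R : realType) (n : nat).
Implicit Types (f : 'rV[R]_n -> R[i]) (s : seq 'I_n).

Definition partials (g : 'rV[R]_n -> R) s : 'rV[R]_n -> R :=
  foldr (fun i h => 'D_(delta_mx ord0 i) h) g s.

Definition smooth (g : 'rV[R]_n -> R) : Prop :=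
  forall s, continuous (partials g s) /\
    forall (i : 'I_n) x, derivable (partials g s) x (delta_mx ord0 i).

Definition csmooth f : Prop := smooth (reC f) /\ smooth (imC f).

Definition cpartials f s (x : 'rV[R]_n) : R[i] :=
  Complex (partials (reC f) s x) (partials (imC f) s x).

Definition schwartz f : Prop :=
  csmooth f /\
  forall (k : nat) s, exists M : R, forall x,
    enorm x ^+ k * normc (cpartials f s x) <= M.

Definition supp f : set 'rV[R]_n := closure [set x | f x != 0].

Definition test_function f : Prop := csmooth f /\ compact (supp f).

(* Continuity of u for the Schwartz topology: u is bounded by finitely many
   of the seminorms sup_x |x|^k |d^s phi(x)|. *)
Definition tempered_distribution (u : ('rV[R]_n -> R[i]) -> R[i]) : Prop :=
  (forall (a : R[i]) phi psi, schwartz phi -> schwartz psi ->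
     u (fun x => a * phi x + psi x) = a * u phi + u psi) /\
  exists (C : R) (N : nat), forall phi (M : R), schwartz phi ->
    (forall (k : nat) s x, (k <= N)%N -> (size s <= N)%N ->
       enorm x ^+ k * normc (cpartials phi s x) <= M) ->
    normc (u phi) <= C * M.

End schwartz.

Section calderon_zygmund.
Context (R : realType) (m n : nat).

Local Notation E := 'rV[R]_n.
Local Notation leb := (@lebesgue_rV R n).

Implicit Types (K : m.+1.-tuple E -> R[i]) (y : m.+1.-tuple E)
  (T : ('I_m -> E -> R[i]) -> (E -> R[i]) -> R[i])
  (F : 'I_m -> E -> R[i]) (S : ('I_m -> E -> R[i]) -> E -> R[i]).

Definition off_diagonal y : Prop := exists k l, tnth y k != tnth y l.

Definition spread y : R :=
  \sum_(k < m.+1) \sum_(l < m.+1) enorm (tnth y k - tnth y l).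

(* The values of K on the diagonal are irrelevant. *)
Definition cz_kernel K : Prop :=
  exists C eps : R, [/\ 0 < C, 0 < eps,
    forall y, off_diagonal y -> normc (K y) <= C / spread y ^+ (m * n) &
    forall y y' (i : 'I_m.+1), off_diagonal y ->
      (forall j, j != i -> tnth y' j = tnth y j) ->
      enorm (tnth y i - tnth y' i) <=
        2^-1 * \big[Num.max/0]_(k < m.+1) enorm (tnth y i - tnth y k) ->
      normc (K y - K y') <=
        C * enorm (tnth y i - tnth y' i) `^ eps /
          spread y `^ ((m * n)%:R + eps)].

Definition kernel_integrand K F (x : E) (y : m.-tuple E) : R[i] :=
  K [tuple of x :: y] * \prod_(i < m) F i (tnth y i).

Definition kernel_integral K F (x : E) : R[i] :=
  cintegral (power_measure leb m) (kernel_integrand K F x).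

Definition operator_into_distributions T : Prop :=
  (forall F, (forall i, schwartz (F i)) -> tempered_distribution (T F)) /\
  forall F (i : 'I_m) (a : R[i]) (f g phi : E -> R[i]),
    (forall j, schwartz (F j)) -> schwartz f -> schwartz g -> schwartz phi ->
    T (dfwith F i (fun x => a * f x + g x)) phi =
    a * T (dfwith F i f) phi + T (dfwith F i g) phi.

(* T(F) coincides, as a distribution, with kernel_integral K F on the
   complement of the intersection of the supports of the F i. *)
Definition represented_by K T : Prop :=
  forall F phi, (forall i, test_function (F i)) -> test_function phi ->
    (forall x, supp phi x -> exists i, ~ supp (F i) x) ->
    T F phi = cintegral leb (fun x => kernel_integral K F x * phi x).

(* S is a bounded extension of T from L^s_0 x ... x L^s_(m-1) to L^t; it is
   unique up to null sets since Schwartz functions are dense in each L^s_i. *)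
Definition bounded_extension T (s : 'I_m -> R) (t : R) S : Prop :=
  [/\ exists2 C : R, 0 < C & forall F, (forall i, cLp leb (s i) (F i)) ->
        cmeasurable (S F) /\
        (cLnorm leb t setT (S F) <=
           C%:E * \prod_(i < m) cLnorm leb (s i) setT (F i))%E,
      forall F (i : 'I_m) (a : R[i]) (f g : E -> R[i]),
        (forall j, cLp leb (s j) (F j)) -> cLp leb (s i) f -> cLp leb (s i) g ->
        {ae leb, forall x, S (dfwith F i (fun x => a * f x + g x)) x =
                           a * S (dfwith F i f) x + S (dfwith F i g) x} &
      forall F phi, (forall i, schwartz (F i)) -> schwartz phi ->
        cintegrable leb (fun x => S F x * phi x) /\
        T F phi = cintegral leb (fun x => S F x * phi x)].

(* The boundedness clause is part of the notion: the kernel conditions alone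
   do not imply it (for m = 1, differentiation has kernel 0). *)
Definition calderon_zygmund_operator K T : Prop :=
  [/\ cz_kernel K, operator_into_distributions T, represented_by K T &
      forall (s : 'I_m -> R) (t : R), (forall i, 1 < s i) ->
        t^-1 = \sum_(i < m) (s i)^-1 -> exists S, bounded_extension T s t S].

Definition near_far (B2 : set E) F (alpha : {ffun 'I_m -> bool}) : 'I_m -> E -> R[i] :=
  fun i => patch (fun=> 0) (if alpha i then ~` B2 else B2) (F i).

(* The operator on locally integrable arguments, on the ball B(x0, r): S is
   the bounded extension, and alpha i = true stands for the choice of f_i^oo. *)
Definition local_operator K S (x0 : E) (r : R) F (x : E) : R[i] :=
  let B2 := eball x0 (2 * r) in
  S (near_far B2 F [ffun=> false]) x +
  \sum_(alpha : {ffun 'I_m -> bool} | alpha != [ffun=> false])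
    kernel_integral K (near_far B2 F alpha) x.

Definition far_integrals_converge K (x0 : E) (r : R) F : Prop :=
  forall x, eball x0 r x ->
  forall alpha : {ffun 'I_m -> bool}, alpha != [ffun=> false] ->
    (cabs_integral (power_measure leb m)
       (kernel_integrand K (near_far (eball x0 (2 * r)) F alpha) x) < +oo)%E.

End calderon_zygmund.

(* Main.v *)
Require Import Defs.
From mathcomp Require Import all_boot all_order all_algebra.
From mathcomp Require Import complex.
From mathcomp Require Import all_classical all_reals all_analysis.
From mathcomp Require Import measurable_realfun ring lra.

(* On B = B(x0, r) the near part f_i = f_i^0 is handled by the bounded extension
   S.  For the far parts, some y_i lies outside B(x0, 2r), so with
   b = max_k |y_k - x0| >= 2r the size condition gives
     |K(x, y)| <= C b^(-mn) <= C' \int_b^oo t^(-mn-1) dt.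
   Tonelli turns the integral of |K| \prod |f_i| into
     \int_{2r}^oo t^(-mn-1) \prod_i \int_{B(x0,t)} |f_i| dt,
   and Hoelder on each ball, |B(x0,t)|^(1-1/p_i) = O(t^(n(1-1/p_i))), gives the
   claimed tail integral, uniformly in x.  Only upper bounds on integrals of
   nonnegative functions occur, so K(x, .) need not be known measurable. *)

Set Implicit Arguments.
Unset Strict Implicit.
Unset Printing Implicit Defensive.

Import Order.TTheory GRing.Theory Num.Theory.
Import numFieldNormedType.Exports.

Local Open Scope classical_set_scope.
Local Open Scope ring_scope.

(** * Integral bounds without measurability *)

(* Unlike [ge0_le_integral], no measurability is needed: the integral of a
   nonnegative function is a supremum over the simple functions below it. *)
Lemma ge0_le_integral_nonmeasurable d (X : measurableType d) (R : realType)
    (mu : {measure set X -> \bar R}) (D : set X) (f g : X -> \bar R) :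
  (forall x, D x -> 0 <= f x)%E -> (forall x, D x -> f x <= g x)%E ->
  (\int[mu]_(x in D) f x <= \int[mu]_(x in D) g x)%E.
Proof.
move=> f0 fg; have g0 x : D x -> (0 <= g x)%E.
  by move=> Dx; exact: le_trans (f0 _ Dx) (fg _ Dx).
rewrite !ge0_integralE//; apply: le_ereal_sup => _ [h hf <-]; exists h => // x.
by apply: le_trans (hf x) _; apply: lee_restrict.
Qed.

(** The positive and negative parts have integrals a, b >= 0, both at most c, the integral of |g|.
    If c is finite then |a - b| <= c; otherwise the bound is trivial. *)
Lemma abse_integral_le_nonmeasurable d (X : measurableType d) (R : realType)
    (mu : {measure set X -> \bar R}) (g : X -> \bar R) :
  (`|\int[mu]_x g x| <= \int[mu]_x `|g x|)%E.
Proof.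
have le_pos : (\int[mu]_x (g^\+ x) <= \int[mu]_x `|g x|)%E.
  apply: ge0_le_integral_nonmeasurable => // x _.
  by rewrite unlock /= ge_max abse_ge0 lee_abs.
have le_neg : (\int[mu]_x (g^\- x) <= \int[mu]_x `|g x|)%E.
  apply: ge0_le_integral_nonmeasurable => // x _.
  by rewrite unlock /= ge_max abse_ge0 -abseN lee_abs.
rewrite integralE; move: le_pos le_neg.
have : (0 <= \int[mu]_x (g^\+ x))%E by exact: integral_ge0.
have : (0 <= \int[mu]_x (g^\- x))%E by exact: integral_ge0.
move: (\int[mu]_x (g^\+ x))%E (\int[mu]_x (g^\- x))%E (\int[mu]_x `|g x|)%E.
move=> [a| |] [b| |] [c| |]; rewrite ?leey//=.
rewrite !lee_fin => b0 a0 ac bc; rewrite ler_norml; lra.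
Qed.

(** The real and imaginary parts are bounded separately and then added, whence the factor 2. *)
Lemma normc_cintegral_le d (X : measurableType d) (R : realType)
    (mu : {measure set X -> \bar R}) (f : X -> R[i]) :
  ((Normc.normc (cintegral mu f))%:E <= 2%:E * cabs_integral mu f)%E.
Proof.
have part (h : X -> R) : (forall x, `|h x| <= Normc.normc (f x)) ->
    ((`|\int[mu]_x h x|)%:E <= cabs_integral mu f)%E.
  move=> hf; apply: (@le_trans _ _ `|\int[mu]_x (h x)%:E|%E).
    (* [Rintegral] takes the value 0 when the extended integral is infinite, so the bound holds in
       that case too. *)
    by rewrite /Rintegral; case: integral => [r| |] /=; rewrite ?normr0 ?leey.
  apply: le_trans (abse_integral_le_nonmeasurable _ _) _.
  by apply: ge0_le_integral_nonmeasurable => // x _; rewrite lee_fin.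
have le_part (a b : R) : `|a| <= Num.sqrt (a ^+ 2 + b ^+ 2).
  by rewrite -sqrtr_sqr ler_wsqrtr// lerDl sqr_ge0.
rewrite mule_natl mule2n.
apply: (@le_trans _ _
    ((`|\int[mu]_x reC f x|)%:E + (`|\int[mu]_x imC f x|)%:E)%E); last first.
  apply: leeD; apply: part => x; rewrite /reC /imC; case: (f x) => a b //=.
  by rewrite addrC.
rewrite -EFinD lee_fin /=; move: (Rintegral _ _ _) (Rintegral _ _ _) => a b.
rewrite -[leRHS]ger0_norm ?addr_ge0// -sqrtr_sqr ler_wsqrtr//.
by rewrite sqrrD !real_normK ?num_real// addrAC lerDl mulrn_wge0// mulr_ge0.
Qed.

(** * Power measures: product integrands, boxes and Tonelli *)

Lemma emeasurable_prod d (X : measurableType d) (R : realType) (D : set X)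
    (I : Type) (s : seq I) (P : pred I) (h : I -> X -> \bar R) :
  (forall i, measurable_fun D (h i)) ->
  measurable_fun D (fun x => \prod_(i <- s | P i) h i x)%E.
Proof.
move=> mh; elim: s => [|i s IH].
  by under eq_fun do rewrite big_nil; exact: measurable_cst.
under eq_fun do rewrite big_cons; case: (P i) => //.
exact: emeasurable_funM.
Qed.

(** Induction on k: Tonelli on the product behind [power_step] splits off the first coordinate. For
    k = 0 the measure is a Dirac mass of total mass 1, matching the empty product. *)
Lemma integral_power_measure_prod d (X : measurableType d) (R : realType)
    (mu : {sigma_finite_measure set X -> \bar R}) k (G : 'I_k -> X -> \bar R) :
  (forall i, measurable_fun setT (G i)) -> (forall i x, 0 <= G i x)%E ->
  (\int[power_measure mu k]_y \prod_(i < k) G i (tnth y i) =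
   \prod_(i < k) \int[mu]_x G i x)%E.
Proof.
elim: k G => [|k IH] G mG G0.
  under eq_integral do rewrite big_ord0.
  by rewrite big_ord0 integral_cst//= mul1e /dirac/= indicE mem_set.
have mprod j (H : 'I_j -> X -> \bar R) : (forall i, measurable_fun setT (H i)) ->
    measurable_fun [set: j.-tuple X] (fun y => \prod_(i < j) H i (tnth y i))%E.
  move=> mH; apply: emeasurable_prod => i.
  exact: measurableT_comp (mH i) (measurable_tnth i).
rewrite big_ord_recl /= ge0_integral_pushforward//=; last 3 first.
- exact: measurable_tcons.
- exact: mprod.
- by move=> y _; exact: prode_ge0.
rewrite preimage_setT fubini_tonelli1//=; last 2 first.
- exact: measurableT_comp (mprod _ _ mG) (@measurable_tcons _ _ _).
- by move=> z; apply: prode_ge0.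
have prodE x z : (\prod_(i < k.+1) G i (tnth (tcons (x, z)) i) =
    G ord0 x * \prod_(i < k) G (lift ord0 i) (tnth z i))%E.
  rewrite big_ord_recl; congr (_ * _)%E; apply: eq_bigr => i _.
  by rewrite [tnth _ _]tnthS.
rewrite /fubini_F /= (eq_integral (fun x =>
    G ord0 x * \prod_(i < k) \int[mu]_x G (lift ord0 i) x)%E); last first.
  move=> x _; under eq_integral do rewrite prodE.
  rewrite ge0_integralZl//; last 2 first.
  - apply: (mprod k (fun i => G (lift ord0 i))) => i; exact: mG.
  - by move=> z _; exact: prode_ge0.
  by rewrite (IH (fun i => G (lift ord0 i))).

by rewrite ge0_integralZr// prode_ge0// => i _; exact: integral_ge0.
Qed.

Lemma measurable_tuple_box d (X : measurableType d) k (A : 'I_k -> set X) :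
  (forall i, measurable (A i)) ->
  measurable [set y : k.-tuple X | forall i, A i (tnth y i)].
Proof.
move=> mA.
rewrite (_ : mkset _ = \big[setI/setT]_(i < k) ((@tnth k X)^~ i @^-1` A i)).
  apply: bigsetI_measurable => i _; rewrite -[X in measurable X]setTI.
  exact: measurable_tnth.
by rewrite -bigcap_seq; apply/seteqP; split => y /= yA i; [move=> _|];
  apply: yA; rewrite /= ?mem_index_enum.
Qed.

(** The indicator of a box is the product of the indicators of its sides. *)
Lemma power_measure_box d (X : measurableType d) (R : realType)
    (mu : {sigma_finite_measure set X -> \bar R}) k (A : 'I_k -> set X) :
  (forall i, measurable (A i)) ->
  power_measure mu k [set y | forall i, A i (tnth y i)] = (\prod_(i < k) mu (A i))%E.
Proof.
move=> mA; set B := (X in power_measure mu k X).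
have mB : measurable B by exact: measurable_tuple_box.
rewrite -[B]setIT -integral_indic//.
rewrite (eq_integral (fun y => \prod_(i < k) (\1_(A i) (tnth y i))%:E)%E).
  rewrite (integral_power_measure_prod _ (G := fun i x => (\1_(A i) x)%:E)).
  - by apply: eq_bigr => i _; rewrite integral_indic// setIT.
  - by move=> i; apply/measurable_EFinP; exact: measurable_indic.
  - by move=> i x; rewrite lee_fin.
move=> y _; rewrite prodEFin indicE; congr EFin.
have [|yB] := boolP (y \in B).
  rewrite inE => yB; rewrite big1// => i _.
  by rewrite indicE mem_set//; exact: yB.
have /existsNP[i yAi] : ~ forall i, A i (tnth y i) by move: yB; rewrite notin_setE.
by rewrite (bigD1 i)//= indicE memNset// mul0r.
Qed.

Section tonelli_power_measure.
Local Open Scope ereal_scope.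
Context d1 d2 (Y : measurableType d1) (X : measurableType d2) (R : realType).
Variables (nu : {sigma_finite_measure set Y -> \bar R})
  (mu : {sigma_finite_measure set X -> \bar R}).
Variables (k : nat) (w : Y -> \bar R) (G : 'I_k -> Y * X -> \bar R).
Hypotheses (mw : measurable_fun setT w) (w0 : forall t, 0 <= w t).
Hypotheses (mG : forall i, measurable_fun setT (G i)) (G0 : forall i z, 0 <= G i z).

Let H (z : Y * k.-tuple X) := w z.1 * \prod_(i < k) G i (z.1, tnth z.2 i).

Let mH : measurable_fun setT H.
Proof.
apply: emeasurable_funM; first exact: measurableT_comp.
apply: emeasurable_prod => i; apply: measurableT_comp => //.
apply: measurable_fun_pair; first exact: measurable_fst.
apply: (measurableT_comp (f := (@tnth k X)^~ i)); last exact: measurable_snd.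
exact: measurable_tnth.
Qed.

Let H0 z : 0 <= H z.
Proof. by rewrite mule_ge0// prode_ge0. Qed.

Lemma measurable_integral_prod : measurable_fun [set: k.-tuple X]
  (fun y => \int[nu]_t (w t * \prod_(i < k) G i (t, tnth y i))).
Proof. exact: measurable_fun_fubini_tonelli_G mH H0. Qed.

Lemma measurable_prod_integral : measurable_fun setT
  (fun t => w t * \prod_(i < k) \int[mu]_x G i (t, x)).
Proof.
apply: emeasurable_funM => //; apply: emeasurable_prod => i.
exact: measurable_fun_fubini_tonelli_F (mG i) (G0 i).
Qed.

(** After exchanging the integrals, the integrand for fixed t is a product of functions of separate
    coordinates, so its integral over the power measure factors. *)
Lemma tonelli_power_measure :
  \int[power_measure mu k]_y \int[nu]_t (w t * \prod_(i < k) G i (t, tnth y i)) =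
  \int[nu]_t (w t * \prod_(i < k) \int[mu]_x G i (t, x)).
Proof.
have mGt t i : measurable_fun setT (fun x => G i (t, x)).
  exact: measurableT_comp (mG i) (measurable_pair1 t).
rewrite -(fubini_tonelli (m1 := nu) (m2 := power_measure mu k) H mH H0).
apply: eq_integral => t _; rewrite /H /= ge0_integralZl//.
- by rewrite (integral_power_measure_prod _ (G := fun i x => G i (t, x))).
- apply: emeasurable_prod => i.
  exact: measurableT_comp (mGt t i) (measurable_tnth i).
- by move=> y _; exact: prode_ge0.
Qed.

End tonelli_power_measure.

(** * Euclidean norm, balls and their volume *)

Section euclidean_norm.
Context (R : realType) (n : nat).
Implicit Types (x y z : 'rV[R]_n) (r t : R).

Lemma enorm_ge0 x : 0 <= enorm x.
Proof. exact: sqrtr_ge0. Qed.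

Lemma enorm_subC x y : enorm (x - y) = enorm (y - x).
Proof.
by rewrite /enorm; congr Num.sqrt; apply: eq_bigr => i _; rewrite !mxE -sqrrN opprB.
Qed.

(** Lagrange's identity: twice the difference of the two sides is the double sum of the squares (a_i
    b_j - a_j b_i)^2. *)
Lemma cauchy_schwarz_sum (I : finType) (a b : I -> R) :
  (\sum_i a i * b i) ^+ 2 <= (\sum_i a i ^+ 2) * \sum_i b i ^+ 2.
Proof.
suff : 0 <= (\sum_i a i ^+ 2) * (\sum_i b i ^+ 2) +
    (\sum_i b i ^+ 2) * (\sum_i a i ^+ 2) - 2 * (\sum_i a i * b i) ^+ 2 by lra.
rewrite expr2 mulr2n mulrDl !mul1r !big_distrlr /= -!big_split/= -sumrB.
apply: sumr_ge0 => i _; rewrite -!big_split/= -sumrB; apply: sumr_ge0 => j _.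
rewrite [leRHS](_ : _ = (a i * b j - a j * b i) ^+ 2) ?sqr_ge0//; ring.
Qed.

Lemma ler_enormD x y : enorm (x + y) <= enorm x + enorm y.
Proof.
rewrite -[leRHS]ger0_norm ?addr_ge0 ?enorm_ge0// -sqrtr_sqr ler_wsqrtr//.
have cs : \sum_i x ord0 i * y ord0 i <= enorm x * enorm y.
  rewrite (le_trans (ler_norm _))// -sqrtr_sqr -sqrtrM ?sumr_ge0// => [|i _].
    by rewrite ler_wsqrtr// cauchy_schwarz_sum.
  exact: sqr_ge0.
rewrite sqrrD !sqr_sqrtr ?sumr_ge0// => [|i _|i _]; rewrite ?sqr_ge0//.
rewrite [leLHS](_ : _ = \sum_i x ord0 i ^+ 2 + (\sum_i x ord0 i * y ord0 i) *+ 2 +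
  \sum_i y ord0 i ^+ 2) ?lerD2r ?lerD2l ?lerMn2r//.
by rewrite -sumrMnl -!big_split/=; apply: eq_bigr => i _; rewrite mxE sqrrD.
Qed.

Lemma ler_enorm_dist z x y : enorm (x - y) <= enorm (x - z) + enorm (z - y).
Proof. by rewrite (le_trans _ (ler_enormD _ _))// addrA subrK. Qed.

Lemma coord_le_enorm x i : `|x ord0 i| <= enorm x.
Proof.
rewrite -sqrtr_sqr ler_wsqrtr// (bigD1 i)//= lerDl sumr_ge0// => j _.
exact: sqr_ge0.
Qed.

Lemma measurable_enorm_sub x0 :
  measurable_fun setT (fun x : 'rV[R]_n => enorm (x - x0)).
Proof.
apply: (measurableT_comp (continuous_measurable_fun (@sqrt_continuous R))).
apply: measurable_sum => i; apply: measurable_funX.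
under eq_fun do rewrite mxE; apply: measurable_funD => //.
exact: measurable_coord_rV.
Qed.

Lemma measurable_eball x0 r : measurable (eball x0 r).
Proof.
rewrite -[eball x0 r]setTI (_ : eball x0 r = (fun x => enorm (x - x0)) @^-1` `]-oo, r[).
  exact: measurable_enorm_sub.
by apply/seteqP; split => x; rewrite /eball /= in_itv.
Qed.

Lemma eball_coord x0 r x : eball x0 r x ->
  forall i, `]x0 ord0 i - r, x0 ord0 i + r[%classic (x ord0 i).
Proof.
move=> xr i; have := le_lt_trans (coord_le_enorm (x - x0) i) xr.
by rewrite !mxE ltr_distlC /= in_itv /= ltrBlDr andbC; lra.
Qed.

(** The ball lies in a cube of side 2r. Only the order r^n matters later, so the exact volume of the
    ball is not computed. *)
Lemma lebesgue_rV_eball_le x0 r : 0 <= r ->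
  (lebesgue_rV (eball x0 r) <= ((2 * r) ^+ n)%:E)%E.
Proof.
move=> r0; pose I i : set R := `]x0 ord0 i - r, x0 ord0 i + r[%classic.
have mI i : measurable (I i) by exact: measurable_itv.
rewrite /lebesgue_rV /pushforward.
apply: (@le_trans _ _ (power_measure (@lebesgue_measure R) n
    [set y | forall i, I i (tnth y i)])).
  apply: le_measure; rewrite ?inE.
  - rewrite -[X in measurable X]setTI.
    exact: measurable_rV_of_tuple (measurable_eball x0 r).
  - exact: measurable_tuple_box.
  - by move=> y /eball_coord yI i; have := yI i; rewrite mxE.
rewrite power_measure_box// (eq_bigr (fun=> (2 * r)%:E)).
  by rewrite prodEFin prodr_const card_ord.
move=> i _; rewrite [LHS](@lebesgue_measure_itv R)/= lte_fin.
case: ifPn => [_|]; first by rewrite -EFinB; congr EFin; ring.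
(* As r >= 0, the interval is empty only for r = 0, and then both sides vanish. *)
by move=> h; congr EFin; lra.
Qed.

(** Local integrability is given on compact sets; a closed cube transfers it to balls. *)
Lemma eball_sub_compact x0 r : exists2 A : set 'rV[R]_n, compact A & eball x0 r `<=` A.
Proof.
exists [set v | forall i, `[x0 ord0 i - r, x0 ord0 i + r]%classic (v ord0 i)].
  apply: (@rV_compact _ _ (fun i => `[x0 ord0 i - r, x0 ord0 i + r]%classic)) => i.
  exact: segment_compact.
move=> x /eball_coord xr i; have := xr i; rewrite /= !in_itv /=; lra.
Qed.

Lemma enorm_le_spread k (y : k.+1.-tuple 'rV[R]_n) i j :
  enorm (tnth y i - tnth y j) <= spread y.
Proof.
rewrite /spread (bigD1 i)//= (bigD1 j)//= -addrA lerDl addr_ge0// sumr_ge0// => a _.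
  exact: enorm_ge0.
by apply: sumr_ge0 => b _; exact: enorm_ge0.
Qed.

End euclidean_norm.

(** * Moduli of complex functions and finite products *)

Lemma measurable_normc d (X : measurableType d) (R : realType) (f : X -> R[i]) :
  cmeasurable f -> measurable_fun setT (fun x => Normc.normc (f x)).
Proof.
move=> [mRe mIm].
rewrite (_ : (fun _ => _) = fun x => Num.sqrt (reC f x ^+ 2 + imC f x ^+ 2)).
  apply: (measurableT_comp (continuous_measurable_fun (@sqrt_continuous R))).
  by apply: measurable_funD; exact: measurable_funX.
by apply/funext => x; rewrite /reC /imC; case: (f x).
Qed.

Local Notation normc := Normc.normc.

Lemma normc_ge0 (R : realType) (z : R[i]) : 0 <= normc z.
Proof. by case: z => a b; exact: sqrtr_ge0. Qed.

Lemma normc_prod (R : realType) (I : finType) (F : I -> R[i]) :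
  normc (\prod_i F i) = \prod_i normc (F i).
Proof. exact: (big_morph _ (@Normc.normcM R) (@Normc.normc1 R)). Qed.

Lemma normc_sum_le (R : realType) (I : finType) (P : pred I) (F : I -> R[i]) :
  normc (\sum_(i | P i) F i) <= \sum_(i | P i) normc (F i).
Proof.
elim/big_rec2 : _ => [|i a b _ ab]; first by rewrite Normc.normc0.
by apply: le_trans (le_normcD _ _) _; rewrite lerD2l.
Qed.

Lemma lee_prod (R : realType) (I : finType) (a b : I -> \bar R) :
  (forall i, 0 <= a i <= b i)%E -> (\prod_i a i <= \prod_i b i)%E.
Proof.
move=> ab; suff : (0 <= \prod_i a i <= \prod_i b i)%E by case/andP.
elim/big_ind2 : _ => [|u1 v1 u2 v2 /andP[u10 u1v1] /andP[u20 u2v2]|i _]; last 1 first.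
- exact: ab.
- by rewrite lee01 lexx.
by rewrite mule_ge0// lee_pmul.
Qed.

Lemma prod_powR (R : realType) (I : finType) (a : R) (e : I -> R) : 0 < a ->
  \prod_i a `^ e i = a `^ (\sum_i e i).
Proof.
move=> a0; apply/esym/(big_morph (powR a)); last exact: powRr0.
by move=> u v; rewrite powRD// (gt_eqF a0) implybT.
Qed.

Lemma cmeasurable_patch d (X : measurableType d) (R : realType) (B : set X)
    (f : X -> R[i]) :
  measurable B -> cmeasurable f -> cmeasurable (patch (fun=> 0) B f).
Proof.
move=> mB [mRe mIm].
rewrite /cmeasurable (_ : reC _ = reC f \_ B); last first.
  by apply/funext => x; rewrite /reC /patch; case: ifP.
rewrite (_ : imC _ = imC f \_ B); last first.
  by apply/funext => x; rewrite /imC /patch; case: ifP.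
by split; apply/(measurable_restrictT _ mB); exact: measurable_funTS.
Qed.

(** * Lebesgue norms: monotonicity, Minkowski and Hoelder *)

Section lebesgue_norm.
Local Open Scope ereal_scope.
Context d (X : measurableType d) (R : realType) (mu : {measure set X -> \bar R}).
Implicit Types (f g h : X -> R[i]) (A B : set X) (s c : R).

Lemma le_poweR_nneg s (a b : \bar R) : (0 <= s)%R -> 0 <= a -> a <= b -> a `^ s <= b `^ s.
Proof.
move=> s0 a0 ab; apply: gt0_ler_poweR => //; rewrite in_itv/= leey andbT//.
exact: le_trans ab.
Qed.

(** Monotonicity of the integral passes through the powers s and 1/s. It serves for
    [local_operator], whose measurability is not established. *)
Lemma le_Lnorm_nonmeasurable s (F G : X -> \bar R) : (0 < s)%R ->
  (forall x, `|F x| <= `|G x|) -> 'N[mu]_s%:E[F] <= 'N[mu]_s%:E[G].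
Proof.
move=> s0 FG; rewrite unlock; apply: le_poweR_nneg.
- by rewrite invr_ge0 ltW.
- by apply: integral_ge0 => x _; exact: poweR_ge0.
apply: ge0_le_integral_nonmeasurable => x _; first exact: poweR_ge0.
by apply: le_poweR_nneg => //; exact: ltW.
Qed.

Lemma cLnorm_ge0 s A f : 0 <= cLnorm mu s A f.
Proof. exact: Lnorm_ge0. Qed.

Lemma le_cLnorm_subset s A B f : (0 < s)%R -> A `<=` B ->
  cLnorm mu s A f <= cLnorm mu s B f.
Proof.
move=> s0 AB; apply: le_Lnorm_nonmeasurable => // x; rewrite !patchE.
case: ifPn => [/[!inE] /AB Bx|_]; first by rewrite mem_set.
by rewrite abse0 abse_ge0.
Qed.

(** Turns the global norms in the bound for the extension into norms over the doubled ball. *)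
Lemma cLnorm_patch s B f : cLnorm mu s setT (patch (fun=> 0%R) B f) = cLnorm mu s B f.
Proof.
rewrite /cLnorm; apply: eq_Lnorm => x; rewrite patch_setT /patch; case: ifPn => // _.
by congr EFin; exact: Normc.normc0.
Qed.

Lemma cLnorm_restrict s A f :
  cLnorm mu s A f = 'N[mu]_s%:E[EFin \o (fun x => normc (f x) * \1_A x)%R].
Proof.
rewrite /cLnorm; apply: eq_Lnorm => x; rewrite /= indicE /patch.
by case: ifPn => _; rewrite ?mulr1 ?mulr0.
Qed.

Lemma Lnorm_cst_indic s c A : (0 < s)%R -> (0 <= c)%R -> measurable A ->
  'N[mu]_s%:E[EFin \o (fun x => c * \1_A x)%R] = c%:E * mu A `^ s^-1.
Proof.
move=> s0 c0 mA; rewrite unlock.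
rewrite (eq_integral (fun x => (c `^ s)%:E * (\1_A x)%:E)); last first.
  move=> x _; rewrite /= ger0_norm ?mulr_ge0// -EFinM; congr EFin.
  by rewrite powRM// indicE; case: (x \in A); rewrite ?powR1 ?powR0 ?gt_eqF.
rewrite ge0_integralZl//; last 2 first.
- by apply/measurable_EFinP; exact: measurable_indic.
- by rewrite lee_fin powR_ge0.
rewrite integral_indic// setIT poweRM ?lee_fin ?powR_ge0//.
by rewrite poweR_EFin -powRrM mulfV ?gt_eqF// powRr1.
Qed.

(** Minkowski is applied to the measurable functions |g| and c 1_A; h enters only through a
    pointwise comparison. *)
Lemma cLnorm_le_add_cst s c A g h : (1 <= s)%R -> (0 <= c)%R -> measurable A ->
  cmeasurable g -> (forall x, A x -> normc (h x) <= normc (g x) + c)%R ->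
  cLnorm mu s A h <= cLnorm mu s setT g + c%:E * mu A `^ s^-1.
Proof.
move=> s1 c0 mA mg hgc; have s0 : (0 < s)%R by exact: lt_le_trans s1.
rewrite -Lnorm_cst_indic// [cLnorm _ _ setT _]cLnorm_restrict.
rewrite (_ : (fun x => _ * \1_setT x)%R = fun x => normc (g x)); last first.
  by apply/funext => x; rewrite indicT mulr1.
apply: le_trans (minkowski_EFin _ _ _ _); last 3 first.
- exact: measurable_normc.
- by apply: measurable_funM => //; exact: measurable_indic.
- exact: s1.
rewrite cLnorm_restrict; apply: le_Lnorm_nonmeasurable => // x.
rewrite /= lee_fin indicE ger0_norm ?mulr_ge0 ?normc_ge0//.
rewrite ger0_norm ?addr_ge0 ?mulr_ge0 ?normc_ge0//.
have [|_] := boolP (x \in A).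
  by rewrite inE => /hgc; rewrite !mulr1.
by rewrite !mulr0 addr0 normc_ge0.
Qed.

(** Hoelder against 1_A, with conjugate exponent 1/(1 - 1/s). *)
Lemma hoelder_indic s A f : (1 < s)%R -> measurable A -> cmeasurable f ->
  \int[mu]_x (normc (f x) * \1_A x)%:E <= cLnorm mu s A f * mu A `^ (1 - s^-1).
Proof.
move=> s1 mA mf; have s0 : (0 < s)%R by exact: lt_trans s1.
have q0 : (0 < 1 - s^-1)%R by rewrite subr_gt0 invf_lt1.
have mfA : measurable_fun setT (fun x => normc (f x) * \1_A x)%R.
  by apply: measurable_funM; [exact: measurable_normc|exact: measurable_indic].
have mA1 : measurable_fun setT (fun x => 1 * \1_A x : R)%R.
  by apply: measurable_funM => //; exact: measurable_indic.
have := hoelder mu mfA mA1 s0 (q := (1 - s^-1)^-1%R).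
rewrite invr_gt0 invrK subrKC => /(_ q0 erefl).
rewrite -cLnorm_restrict Lnorm_cst_indic ?invr_gt0// invrK mul1e.
apply: le_trans; rewrite Lnorm1; apply: ge0_le_integral_nonmeasurable => x _.
  by rewrite lee_fin mulr_ge0 ?normc_ge0.
rewrite lee_fin /= mul1r ger0_norm ?mulr_ge0 ?normc_ge0// -mulrA indicE.
by case: (x \in A); rewrite ?mulr1 ?mulr0.
Qed.

End lebesgue_norm.

(** * Powers bounded by tail integrals *)

Section kernel_tail.
Context (R : realType).
Local Notation mu := (@lebesgue_measure R).

(** The piece ]b, 2b] of the tail suffices: it has length b and t^(-q-1) >= (2b)^(-q-1) on it, so it
    contributes at least 2^(-q-1) b^(-q). *)
Lemma powRN_le_tail (q b : R) : 0 <= q -> 0 < b ->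
  ((b `^ (- q))%:E <= (2 `^ (q + 1))%:E *
     \int[mu]_t (t `^ (- q - 1) * \1_(`]b, +oo[) t)%:E)%E.
Proof.
move=> q0 b0; have q10 : 0 <= q + 1 by lra.
have mI : measurable (`]b, (2 * b)] : set R) by exact: measurable_itv.
have muI : mu `]b, (2 * b)] = b%:E.
  rewrite lebesgue_measure_itv/= lte_fin (_ : b < 2 * b); last by lra.
  by rewrite -EFinB; congr EFin; ring.
have -> : (b `^ (- q))%:E = ((2 `^ (q + 1))%:E *
    \int[mu]_t (((2 * b) `^ (- q - 1))%:E * (\1_(`]b, (2 * b)]) t)%:E))%E.
  rewrite ge0_integralZl//; last 2 first.
  - by apply/measurable_EFinP; exact: measurable_indic.
  - by rewrite lee_fin powR_ge0.
  rewrite integral_indic// setIT [X in (_ * (_ * X))%E]muI -!EFinM; congr EFin.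
  rewrite (_ : - q - 1 = - (q + 1)); last by ring.
  rewrite !powRN powRM ?ltW//.
  rewrite [b `^ (q + 1)]powRD; last by rewrite (gt_eqF b0) implybT.
  rewrite powRr1 ?ltW//.
  have c2 : (2 : R) `^ (q + 1) != 0 by rewrite gt_eqF// powR_gt0.
  have cb : b `^ q != 0 by rewrite gt_eqF// powR_gt0.
  by field; rewrite c2 cb gt_eqF.
rewrite lee_wpmul2l ?lee_fin ?powR_ge0//.
apply: ge0_le_integral_nonmeasurable => t _.
  by rewrite -EFinM lee_fin mulr_ge0 ?powR_ge0.
rewrite -EFinM lee_fin !indicE; have [|_] := boolP (t \in `]b, (2 * b)]%classic).
  rewrite inE /= in_itv /= => /andP[bt t2b].
  rewrite mem_set ?mulr1; last by rewrite /= in_itv/= bt.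
  have b20 : 0 < 2 * b by lra.
  rewrite (_ : - q - 1 = - (q + 1)); last by ring.
  rewrite !powRN lef_pV2 ?posrE ?powR_gt0 ?(lt_trans b0 bt)//.
  by apply: ge0_ler_powR => //; rewrite nnegrE; lra.
by rewrite mulr0 mulr_ge0 ?powR_ge0.
Qed.

End kernel_tail.

(** * Far parts: kernel decay, Tonelli and Hoelder on balls *)

Section far_estimate.
Context (R : realType) (m n : nat).
Local Notation E := 'rV[R]_n.
Local Notation leb := (@lebesgue_rV R n).
Local Notation mu := (@lebesgue_measure R).
Variables (K : m.+1.-tuple E -> R[i]) (C : R).
Hypothesis C0 : 0 < C.
Hypothesis K_size : forall y, off_diagonal y -> normc (K y) <= C / spread y ^+ (m * n).

(** With b = |y_j - x0| >= 2r and |x - x0| < r, the distance |x - y_j| is at least b - r >= b/2, and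
    it is one term of [spread]. *)
Lemma kernel_far_le (x0 x : E) r (y : m.-tuple E) j : 0 < r -> eball x0 r x ->
  2 * r <= enorm (tnth y j - x0) ->
  normc (K [tuple of x :: y]) <=
    C * 2 ^+ (m * n) * enorm (tnth y j - x0) `^ (- (m * n)%:R).
Proof.
move=> r0 xr yr; set z := [tuple of x :: y]; set b := enorm _.
have b0 : 0 < b by apply: lt_le_trans yr; rewrite mulr_gt0.
have z0 : tnth z ord0 = x by [].
have zj : tnth z (lift ord0 j) = tnth y j by rewrite tnthS.
have bz : b / 2 <= enorm (tnth z ord0 - tnth z (lift ord0 j)).
  have := ler_enorm_dist x (tnth y j) x0; rewrite -/b z0 zj (enorm_subC x (tnth y j)).
  by move: xr yr; rewrite /eball /= -/b; lra.
have zoff : off_diagonal z.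
  (* If x and y_j coincided, the previous bound would give b/2 <= 0. *)
  exists ord0, (lift ord0 j); apply/eqP => zE; move: bz; rewrite zE subrr.
  rewrite /enorm big1 ?sqrtr0; first by lra.
  by move=> i _; rewrite mxE expr0n.
apply: le_trans (K_size zoff) _.
rewrite powR_invn ?(ltW b0)// -[leRHS]mulrA ler_pM2l//.
rewrite [leRHS](_ : _ = ((b / 2) ^+ (m * n))^-1); last first.
  by rewrite expr_div_n invf_div.
have bs : b / 2 <= spread z by exact: le_trans bz (enorm_le_spread _ _ _).
rewrite lef_pV2 ?posrE ?exprn_gt0 ?(lt_le_trans _ bs) ?divr_gt0//.
by rewrite lerXn2r// nnegrE; lra.
Qed.

Lemma normc_near_far_le (B : set E) (f : 'I_m -> E -> R[i]) alpha i x :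
  normc (near_far B f alpha i x) <= normc (f i x).
Proof.
rewrite /near_far /patch; case: ifPn => // _.
by rewrite Normc.normc0 normc_ge0.
Qed.

Lemma near_far_exists (alpha : {ffun 'I_m -> bool}) :
  alpha != [ffun=> false] -> exists i, alpha i.
Proof.
apply: contra_neqP => /forallNP h; apply/ffunP => i; rewrite ffunE.
exact/negbTE/negP.
Qed.

(** The cut-off is at 2r and not at b, so that the weight does not depend on y. *)
Let tail_weight (r t : R) : R := t `^ (- (m * n)%:R - 1) * \1_(`](2 * r), +oo[) t.

(** Radius and point form one variable z = (t, x), since Tonelli requires joint measurability. *)
Let ball_part (f : 'I_m -> E -> R[i]) (x0 : E) i (z : R * E) : R :=
  normc (f i z.2) * \1_(eball x0 z.1) z.2.

(** C 2^(mn) comes from the kernel bound, 2^(mn+1) from replacing b^(-mn) by a tail integral. *)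
Let far_const : R := C * 2 ^+ (m * n) * 2 `^ ((m * n)%:R + 1).

Lemma kernel_integrand_far_le (x0 x : E) r f alpha (y : m.-tuple E) :
  0 < r -> eball x0 r x -> alpha != [ffun=> false] ->
  ((normc (kernel_integrand K (near_far (eball x0 (2 * r)) f alpha) x y))%:E <=
   far_const%:E * \int[mu]_t ((tail_weight r t)%:E *
     \prod_(i < m) (ball_part f x0 i (t, tnth y i))%:E))%E.
Proof.
move=> r0 xr /near_far_exists[i ai]; rewrite /kernel_integrand Normc.normcM normc_prod.
have w0 t : 0 <= tail_weight r t by rewrite mulr_ge0 ?powR_ge0.
have g0 t k : 0 <= ball_part f x0 k (t, tnth y k) by rewrite mulr_ge0 ?normc_ge0.
have A0 : 0 <= far_const by rewrite !mulr_ge0 ?powR_ge0 ?exprn_ge0 ?(ltW C0).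
(* Here f_i is replaced by its far part, so the left side is 0 when y_i lies in the doubled ball. *)
have [yi|yi] := ltP (enorm (tnth y i - x0)) (2 * r).
  rewrite [X in _ * X](bigD1 i)//= {1}/near_far ai /patch memNset; last by apply.
  rewrite Normc.normc0 mul0r mulr0 mule_ge0 ?lee_fin//.
  by apply: integral_ge0 => t _; rewrite mule_ge0 ?prode_ge0// => *; rewrite lee_fin.
(* The point y_j farthest from x0 governs the kernel decay; for t > b = |y_j - x0| every y_k lies in
   B(x0, t). *)
have [j _ ymax] := @Order.TotalTheory.arg_maxP _ _ _ i xpredT
  (fun k => enorm (tnth y k - x0)) erefl.
set b := enorm (tnth y j - x0) in ymax.
have b2r : 2 * r <= b by exact: le_trans yi (ymax i erefl).
have b0 : 0 < b by apply: lt_le_trans b2r; rewrite mulr_gt0.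
pose P := \prod_(k < m) normc (f k (tnth y k)).
have P0 : 0 <= P by apply: prodr_ge0 => k _; exact: normc_ge0.
apply: (@le_trans _ _ ((C * 2 ^+ (m * n) * b `^ (- (m * n)%:R)) * P)%:E).
  rewrite lee_fin ler_pM ?normc_ge0 ?prodr_ge0//.
  - by move=> k _; exact: normc_ge0.
  - exact: (kernel_far_le r0 xr b2r).
  - by rewrite /P; apply: ler_prod => k _; rewrite normc_ge0 normc_near_far_le.
have C1 : 0 <= C * 2 ^+ (m * n) by rewrite mulr_ge0 ?exprn_ge0 ?(ltW C0).
have q0 : 0 <= (m * n)%:R :> R by [].
rewrite EFinM [(_ * _ * _)%:E]EFinM.
apply: le_trans (lee_wpmul2r _ (lee_wpmul2l _ (powRN_le_tail q0 b0))) _.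
- by rewrite lee_fin.
- by rewrite lee_fin.
rewrite -!muleA muleA -EFinM lee_wpmul2l ?lee_fin// -ge0_integralZr//; last 2 first.
- apply/measurable_EFinP/measurable_funM; last exact: measurable_indic.
  exact: measurable_powR.
- by move=> t _; rewrite lee_fin mulr_ge0 ?powR_ge0.
apply: ge0_le_integral_nonmeasurable => t _.
  by rewrite -EFinM lee_fin !mulr_ge0 ?powR_ge0.
rewrite prodEFin -!EFinM lee_fin indicE.
(* For t <= b the left integrand is 0; for t > b all cut-offs on the right equal 1. *)
have [|_] := boolP (t \in `]b, +oo[%classic); last first.
  by rewrite mulr0 mul0r mulr_ge0// prodr_ge0.
rewrite inE /= in_itv /= andbT mulr1 => bt.
rewrite /tail_weight indicE mem_set ?mulr1; last first.
  by rewrite /= in_itv/= andbT (le_lt_trans b2r).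
rewrite ler_wpM2l ?powR_ge0// ler_prod// => k _; rewrite normc_ge0 /ball_part /=.
by rewrite indicE mem_set ?mulr1//; exact: le_lt_trans (ymax k erefl) bt.
Qed.

Let measurable_tail_weight r : measurable_fun setT (EFin \o tail_weight r).
Proof.
apply/measurable_EFinP/measurable_funM; last exact: measurable_indic.
exact: measurable_powR.
Qed.

(** The set |x - x0| < t in the product space is the preimage of ]0, +oo[ under the measurable map t
    - |x - x0|. *)
Let measurable_ball_part f x0 i : cmeasurable (f i) ->
  measurable_fun setT (EFin \o ball_part f x0 i).
Proof.
move=> mf; apply/measurable_EFinP/measurable_funM.
  by apply: (measurableT_comp (f := fun x => normc (f i x))) => //; exact: measurable_normc.
pose A : set (R * E) := [set z | enorm (z.2 - x0) < z.1].
rewrite (_ : (fun z => _) = \1_A).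
  apply: measurable_indic; rewrite -[X in measurable X]setTI.
  rewrite (_ : A = (fun z => z.1 - enorm (z.2 - x0)) @^-1` `]0, +oo[).
    suff : measurable_fun setT (fun z : R * E => z.1 - enorm (z.2 - x0)) by exact.
    apply: measurable_funB => //.
    by apply: (measurableT_comp (measurable_enorm_sub x0)).
  by apply/seteqP; split => z; rewrite /A /= in_itv/= andbT subr_gt0.
by apply/funext => z; rewrite !indicE; congr (_%:R); apply/idP/idP; rewrite !inE.
Qed.

Let tail_weight_ge0 r t : (0 <= (tail_weight r t)%:E)%E.
Proof. by rewrite lee_fin mulr_ge0 ?powR_ge0. Qed.

Let ball_part_ge0 f x0 i z : (0 <= (ball_part f x0 i z)%:E)%E.
Proof. by rewrite lee_fin mulr_ge0 ?normc_ge0. Qed.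

Lemma cabs_integral_far_le (x0 x : E) r f alpha :
  0 < r -> (forall i, cmeasurable (f i)) -> eball x0 r x -> alpha != [ffun=> false] ->
  (cabs_integral (power_measure leb m)
     (kernel_integrand K (near_far (eball x0 (2 * r)) f alpha) x) <=
   far_const%:E * \int[mu]_t ((tail_weight r t)%:E *
     \prod_(i < m) \int[leb]_x (ball_part f x0 i (t, x))%:E))%E.
Proof.
move=> r0 mf xr alpha0.
have mG i := measurable_ball_part x0 (mf i).
rewrite /cabs_integral -(tonelli_power_measure mu leb (measurable_tail_weight r)
  (tail_weight_ge0 r) mG (ball_part_ge0 f x0)) -ge0_integralZl//; last 3 first.
- exact: (measurable_integral_prod mu (measurable_tail_weight r)
    (tail_weight_ge0 r) mG (ball_part_ge0 f x0)).
- move=> y _; apply: integral_ge0 => t _; rewrite mule_ge0 ?prode_ge0// => [|i _].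
    exact: tail_weight_ge0.
  exact: ball_part_ge0.
- by rewrite lee_fin !mulr_ge0 ?powR_ge0 ?exprn_ge0 ?(ltW C0).
apply: ge0_le_integral_nonmeasurable => y _; first by rewrite lee_fin normc_ge0.
exact: kernel_integrand_far_le.
Qed.

Variables (p : R) (ps : 'I_m -> R).
Hypothesis ps1 : forall i, 1 < ps i.
Hypothesis pps : p^-1 = \sum_(i < m) (ps i)^-1.

(** The product over i of the factors 2^(n(1 - 1/p_i)) coming from the volume bound (2t)^n. *)
Let hoelder_const : R := 2 `^ (n%:R * (m%:R - p^-1)).

(** Hoelder contributes (2t) to the power n(1 - 1/p_i) for each i. These exponents add up to mn -
    n/p, which turns t^(-mn-1) into t^(-n/p-1). *)
Lemma weighted_hoelder_ball (x0 : E) t f : 0 < t -> (forall i, cmeasurable (f i)) ->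
  ((t `^ (- (m * n)%:R - 1))%:E * \prod_(i < m) \int[leb]_x (ball_part f x0 i (t, x))%:E <=
   hoelder_const%:E * (\prod_(i < m) cLnorm leb (ps i) (eball x0 t) (f i) *
     (t `^ (- (n%:R / p) - 1))%:E))%E.
Proof.
move=> t0 mf; have t20 : 0 < 2 * t by rewrite mulr_gt0.
have tn0 : 0 < (2 * t) ^+ n by rewrite exprn_gt0.
have factor i : (0 <= \int[leb]_x (ball_part f x0 i (t, x))%:E <=
    cLnorm leb (ps i) (eball x0 t) (f i) * (((2 * t) ^+ n) `^ (1 - (ps i)^-1))%:E)%E.
  rewrite integral_ge0/=; last by move=> x _; exact: ball_part_ge0.
  apply: le_trans (hoelder_indic leb (ps1 i) (measurable_eball x0 t) (mf i)) _.
  rewrite lee_wpmul2l ?cLnorm_ge0// -poweR_EFin le_poweR_nneg//.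
    by rewrite subr_ge0 invf_le1 ?ltW// (lt_trans _ (ps1 i)).
  by rewrite lebesgue_rV_eball_le// ltW.
apply: le_trans (lee_wpmul2l _ (lee_prod factor)) _; first by rewrite lee_fin powR_ge0.
rewrite big_split/= prodEFin prod_powR//.
rewrite muleCA [leRHS]muleCA -!EFinM.
rewrite [leRHS](_ : _ = \prod_(i < m) cLnorm leb (ps i) (eball x0 t) (f i) *
  (hoelder_const * t `^ (- (n%:R / p) - 1))%:E)%E; last by rewrite EFinM.
rewrite (_ : t `^ _ * _ = hoelder_const * t `^ (- (n%:R / p) - 1))//.
rewrite sumrB -pps sumr_const card_ord -powR_mulrn ?(ltW t20)// -powRrM.
rewrite powRM ?(ltW t0)// mulrCA -powRD; last by rewrite (gt_eqF t0) implybT.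
by congr (_ * t `^ _); rewrite natrM; ring.
Qed.

Lemma cabs_integral_far_le_tail : exists2 A : R, 0 < A &
  forall (x0 x : E) r f (alpha : {ffun 'I_m -> bool}), 0 < r ->
  (forall i, cmeasurable (f i)) -> eball x0 r x -> alpha != [ffun=> false] ->
  (cabs_integral (power_measure leb m)
     (kernel_integrand K (near_far (eball x0 (2 * r)) f alpha) x) <=
   A%:E * \int[mu]_(t in `](2 * r)%R, +oo[)
     (\prod_(i < m) cLnorm leb (ps i) (eball x0 t) (f i) *
      (t `^ (- (n%:R / p) - 1))%:E))%E.
Proof.
exists (far_const * hoelder_const).
  by rewrite !mulr_gt0 ?powR_gt0 ?exprn_gt0.
move=> x0 x r f alpha r0 mf xr alpha0; apply: le_trans (cabs_integral_far_le r0 mf xr alpha0) _.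
have mG i := measurable_ball_part x0 (mf i).
have D0 : 0 < hoelder_const by exact: powR_gt0.
rewrite [X in (_ <= X * _)%E](EFinM far_const) -[leRHS]muleA lee_wpmul2l//.
  by rewrite lee_fin !mulr_ge0 ?powR_ge0 ?exprn_ge0 ?(ltW C0).
(* The constant moves to the left, where the integrand is known to be measurable, and there goes
   under the integral. *)
rewrite -lee_pdivrMl// -ge0_integralZl//; last 3 first.
- exact: (measurable_prod_integral leb (measurable_tail_weight r) mG (ball_part_ge0 f x0)).
- move=> t _; rewrite mule_ge0 ?tail_weight_ge0// prode_ge0// => i _.
  by apply: integral_ge0 => z _; exact: ball_part_ge0.
- by rewrite lee_fin invr_ge0 ltW.
rewrite [leRHS]integral_mkcond; apply: ge0_le_integral_nonmeasurable => t _.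
  rewrite mule_ge0 ?lee_fin ?invr_ge0 ?(ltW D0)// mule_ge0 ?tail_weight_ge0//.
  by apply: prode_ge0 => i _; apply: integral_ge0 => z _; exact: ball_part_ge0.
rewrite lee_pdivrMl// patchE /tail_weight indicE; case: ifPn => [|_].
  rewrite inE /= in_itv/= andbT mulr1 => rt.
  by apply: weighted_hoelder_ball => //; apply: lt_trans rt; rewrite mulr_gt0.
by rewrite mulr0 mul0e mule0.
Qed.

End far_estimate.

(** * Near part *)

(** Each norm over B(x0, t) increases with t, so on t > 2r the product over the doubled ball lies
    below the integrand's product; (2r)^(-n/p) is bounded by the tail of t^(-n/p-1). *)
Lemma near_prod_le_tail (R : realType) (m n : nat) (p : R) (ps : 'I_m -> R)
    (x0 : 'rV[R]_n) r (f : 'I_m -> 'rV[R]_n -> R[i]) :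
  0 < r -> 0 <= p -> (forall i, 0 < ps i) ->
  (\prod_(i < m) cLnorm (@lebesgue_rV R n) (ps i) (eball x0 (2 * r)) (f i) <=
   ((2 * r) `^ (n%:R / p) * 2 `^ (n%:R / p + 1))%:E *
   \int[@lebesgue_measure R]_(t in `](2 * r)%R, +oo[)
     (\prod_(i < m) cLnorm (@lebesgue_rV R n) (ps i) (eball x0 t) (f i) *
      (t `^ (- (n%:R / p) - 1))%:E))%E.
Proof.
move=> r0 p0 ps0; have r20 : 0 < 2 * r by rewrite mulr_gt0.
have q0 : 0 <= n%:R / p by rewrite divr_ge0.
set P := (\prod_(i < m) _)%E.
have P0 : (0 <= P)%E by apply: prode_ge0 => i _; exact: cLnorm_ge0.
have -> : P = (((2 * r) `^ (n%:R / p))%:E * (((2 * r) `^ (- (n%:R / p)))%:E * P))%E.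
  by rewrite muleA -EFinM powRN divff ?mul1e// gt_eqF// powR_gt0.
rewrite [in leRHS]EFinM -[leRHS]muleA lee_wpmul2l ?lee_fin ?powR_ge0//.
apply: le_trans (lee_wpmul2r P0 (powRN_le_tail q0 r20)) _.
rewrite -muleA lee_wpmul2l ?lee_fin ?powR_ge0// -ge0_integralZr//; last 2 first.
- apply/measurable_EFinP/measurable_funM; last exact: measurable_indic.
  exact: measurable_powR.
- by move=> t _; rewrite lee_fin mulr_ge0 ?powR_ge0.
rewrite [leRHS]integral_mkcond; apply: ge0_le_integral_nonmeasurable => t _.
  by rewrite mule_ge0// lee_fin mulr_ge0 ?powR_ge0.
rewrite patchE indicE; case: ifPn => [|_]; last by rewrite mulr0 mul0e.
rewrite inE /= in_itv/= andbT mulr1 muleC => rt.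
rewrite lee_wpmul2r ?lee_fin ?powR_ge0// lee_prod// => i.
rewrite cLnorm_ge0 le_cLnorm_subset// => x.
by rewrite /eball /= => /lt_trans; exact.
Qed.

(** * Assembly of the near and far estimates *)

Theorem theorem3p1 (R : realType) (m n : nat) (hm : (0 < m)%N) (hn : (0 < n)%N)
  (K : m.+1.-tuple 'rV[R]_n -> R[i])
  (T : ('I_m -> 'rV[R]_n -> R[i]) -> ('rV[R]_n -> R[i]) -> R[i])
  (hT : calderon_zygmund_operator K T)
  (x0 : 'rV[R]_n) (p : R) (ps : 'I_m -> R)
  (hp : 1 < p) (hps : forall i, 1 < ps i) (hpps : p^-1 = \sum_(i < m) (ps i)^-1)
  (S : ('I_m -> 'rV[R]_n -> R[i]) -> 'rV[R]_n -> R[i])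
  (hS : bounded_extension T ps p S) :
  exists2 C : R, 0 < C &
    forall (r : R) (f : 'I_m -> 'rV[R]_n -> R[i]),
      0 < r -> (forall i, cLp_loc (ps i) (f i)) ->
      let tail := (\int[@lebesgue_measure R]_(t in `](2 * r)%R, +oo[)
        (\prod_(i < m) cLnorm (@lebesgue_rV R n) (ps i) (eball x0 t) (f i) *
         (t `^ (- (n%:R / p) - 1))%:E))%E in
      ((tail < +oo)%E -> far_integrals_converge K x0 r f) /\
      (cLnorm (@lebesgue_rV R n) p (eball x0 r) (local_operator K S x0 r f) <=
         (C * r `^ (n%:R / p))%:E * tail)%E.
Proof.
have [[Ck [eps [Ck0 _ K_size _]]] _ _ _] := hT.
have [[Cs Cs0 S_bound] _ _] := hS.
have [A A0 far_le] := cabs_integral_far_le_tail Ck0 K_size hps hpps.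
have p0 : 0 < p by lra.
have ps0 i : 0 < ps i by have := hps i; lra.
(* N = 2^m - 1, the number of choices with at least one far factor. *)
pose N : R := \sum_(alpha : {ffun 'I_m -> bool} | alpha != [ffun=> false]) 1.
have N0 : 0 <= N by exact: sumr_ge0.
pose c2 : R := 2 `^ (n%:R / p).
have c20 : 0 < c2 by exact: powR_gt0.
pose c3 : R := 2 `^ (n%:R / p + 1).
have c30 : 0 < c3 by exact: powR_gt0.
(* The first summand serves the near part, the second the far part; c2 arises in both from
   (2r)^(n/p) = c2 r^(n/p). *)
exists (Cs * (c2 * c3) + 2 * A * N * c2).
  by rewrite ltr_wpDr ?mulr_gt0// !mulr_ge0 ?(ltW A0) ?(ltW c20).
move=> r f r0 hf tail.
have rq0 : 0 < r `^ (n%:R / p) by exact: powR_gt0.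
have mf i : cmeasurable (f i) by have [] := hf i.
have tail0 : (0 <= tail)%E.
  apply: integral_ge0 => t _; rewrite mule_ge0 ?lee_fin ?powR_ge0// prode_ge0// => i _.
  exact: cLnorm_ge0.
split=> [tailoo x xr alpha alpha0|].
  apply: le_lt_trans (far_le _ _ _ _ _ r0 mf xr alpha0) _.
  by rewrite lte_mul_pinfty ?lee_fin ?(ltW A0).
(* For an infinite tail the right-hand side is +oo, its constant being positive. *)
have [->|tailoo] := eqVneq tail +oo%E.
  by rewrite gt0_muley ?leey// lte_fin mulr_gt0// ltr_wpDr ?mulr_gt0// !mulr_ge0
    ?(ltW A0) ?(ltW c20).
have tailE : tail = (fine tail)%:E by rewrite fineK// ge0_fin_numE// ltey.
have fine0 : 0 <= fine tail by exact: fine_ge0.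
pose B2 := eball x0 (2 * r).
pose F0 := near_far B2 f [ffun=> false].
have F0E i : F0 i = patch (fun=> 0) B2 (f i) by rewrite /F0 /near_far ffunE.
have F0_Lp i : cLp (@lebesgue_rV R n) (ps i) (F0 i).
  rewrite F0E; split; first exact: cmeasurable_patch (measurable_eball _ _) (mf i).
  have [L cL BL] := eball_sub_compact x0 (2 * r).
  rewrite cLnorm_patch; apply: le_lt_trans (le_cLnorm_subset _ _ (ps0 i) BL) _.
  by have [_] := hf i; exact.
have [mS S_le] := S_bound F0 F0_Lp.
(* A bound for the far sum uniform in x: N terms, each at most 2 A times the tail, with 2 from the
   complex integral. *)
pose c := 2 * A * N * fine tail.
have c0 : 0 <= c by rewrite !mulr_ge0// ltW.
have far_sum x : eball x0 r x ->
    normc (local_operator K S x0 r f x) <= normc (S F0 x) + c.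
  move=> xr; apply: le_trans (le_normcD _ _) _; rewrite lerD2l.
  apply: le_trans (normc_sum_le _ _) _.
  rewrite (_ : c = \sum_(alpha : {ffun 'I_m -> bool} | alpha != [ffun=> false])
      (2 * (A * fine tail))); last first.
    under eq_bigr do rewrite -[2 * _]mulr1.
    by rewrite -mulr_sumr -/N /c; ring.
  apply: ler_sum => alpha alpha0; rewrite -lee_fin.
  apply: le_trans (normc_cintegral_le _ _) _.
  rewrite EFinM lee_wpmul2l ?lee_fin// EFinM -tailE.
  exact: far_le _ _ _ _ _ r0 mf xr alpha0.
(* It remains to bound the norm of [S F0] over the whole space and c |B|^(1/p), one summand of the
   constant for each. *)
apply: le_trans (cLnorm_le_add_cst _ (ltW hp) c0 (measurable_eball x0 r) mS far_sum) _.
rewrite tailE -EFinM [X in (_ <= X%:E)%E](_ : _ =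
  Cs * ((c2 * r `^ (n%:R / p)) * c3 * fine tail) + c * (c2 * r `^ (n%:R / p))); last first.
  by rewrite /c; ring.
have c2r : c2 * r `^ (n%:R / p) = (2 * r) `^ (n%:R / p) by rewrite powRM// ltW.
rewrite EFinD leeD//.
  apply: le_trans S_le _; rewrite EFinM lee_wpmul2l ?lee_fin ?(ltW Cs0)//.
  rewrite c2r EFinM -tailE; apply: le_trans (near_prod_le_tail _ _ r0 (ltW p0) ps0).
  by apply: lee_prod => i; rewrite cLnorm_ge0 F0E cLnorm_patch lexx.
rewrite [leRHS]EFinM lee_wpmul2l ?lee_fin// c2r.
(* (2r)^(n/p) is rewritten as the power 1/p of the volume bound (2r)^n for B. *)
rewrite [X in (_ <= X%:E)%E](_ : _ = ((2 * r) ^+ n) `^ p^-1); last first.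
  by rewrite -powR_mulrn ?mulr_ge0 ?(ltW r0)// -powRrM.
rewrite -poweR_EFin le_poweR_nneg ?invr_ge0 ?(ltW p0)//.
by rewrite lebesgue_rV_eball_le// ltW.
Qed.
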